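(* The direction $n_\infty\in\mathbb{S}^2$ is a critical point of the energy function $E_0(\mathcal{M};\cdot):\mathbb{S}^2\to\mathbb{R}$ if and only if $$\int_{\mathcal{M}}\frac{(\nu\cdot n_\infty)\nu-(\nu\cdot n_\infty)^2n_\infty}{\sqrt{1-(\nu\cdot n_\infty)^2}}\,d\mathcal{H}^2(\omega)=0.$$
   Context: $\mathcal{M}\subset\mathbb{R}^3$ is a $C^{2,1}$, connected, compact, oriented $2$-manifold without boundary, bounding a compact domain, with outward unit normal $\nu:\mathcal{M}\to\mathbb{S}^2$. For $n\in\mathbb{S}^2$, $$E_0(\mathcal{M};n)=\int_{\mathcal{M}}\sqrt[4]{24}\Big(1-\sqrt{1-(\nu\cdot n)^2}\Big)\,d\mathcal{H}^2.$$ A direction $n\in\mathbb{S}^2$ is a critical point of $E_0(\mathcal{M};\cdot)$ if for every $m\in\mathbb{S}^2$, with $n_t=\frac{n+tm}{|n+tm|}$, one has $\frac{d}{dt}E_0(\mathcal{M};n_t)\big|_{t=0}=0$.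
   Formalization: The integral condition is read as also requiring that its integrand be defined almost everywhere, i.e. that the set where ν = ±n_∞ has zero area; otherwise the integrand is 0/0 on a set of positive area, and with value 0 there the ''if'' direction fails (smoothed cube with flat facets). *)

(* Defs.v *)
From HB Require Import structures.
From mathcomp Require Import all_boot all_order all_algebra.
From mathcomp Require Import all_classical all_reals all_analysis.

Set Implicit Arguments.
Unset Strict Implicit.
Unset Printing Implicit Defensive.
Import Order.TTheory GRing.Theory Num.Theory.
Import numFieldNormedType.Exports.

Local Open Scope classical_set_scope.
Local Open Scope ring_scope.

(* The norm [`|x|] that the library puts on ['rV[R]_n] is the sup norm, so the
   Euclidean structure is introduced separately. *)
Definition dot (R : realType) (n : nat) (u v : 'rV[R]_n) : R :=
  \sum_(i < n) u 0 i * v 0 i.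

Definition enorm (R : realType) (n : nat) (u : 'rV[R]_n) : R :=
  Num.sqrt (dot u u).

Definition sphere2 (R : realType) : set 'rV[R]_3 := [set u | enorm u = 1].

Section Hausdorff.
Local Open Scope ereal_scope.
Context {R : realType} {n : nat}.
Implicit Types (A : set 'rV[R]_n.+1) (C : (set 'rV[R]_n.+1)^nat).

(* Joining 0 gives the empty set diameter 0 and changes nothing otherwise. *)
Definition ediam A : \bar R :=
  ereal_sup (0 |` [set (enorm (x - y))%:E | x in A & y in A]).

Definition hausdorff2_cover (delta : R) A C : Prop :=
  A `<=` \bigcup_i C i /\ forall i, ediam (C i) <= delta%:E.

(* pi / 4 is the area of a disc of unit diameter: with this normalization the
   measure of a smooth surface is its usual area. *)
Definition hausdorff2_delta (delta : R) A : \bar R :=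
  ereal_inf [set \sum_(i <oo) ((pi / 4)%R%:E * ediam (C i) ^+ 2)
            | C in hausdorff2_cover delta A].

Definition hausdorff2 A : \bar R :=
  ereal_sup [set hausdorff2_delta delta A | delta in [set d | (0 < d)%R]].

Lemma ediam_ge0 A : 0 <= ediam A.
Proof. by apply: ereal_sup_ubound; left. Qed.

Lemma ediam0 : ediam set0 = 0.
Proof.
apply/eqP; rewrite eq_le ediam_ge0 andbT.
by apply: ge_ereal_sup => _ [->//|[x []]].
Qed.

Let weight_ge0 A : 0 <= (pi / 4)%R%:E * ediam A ^+ 2.
Proof.
apply: mule_ge0; first by rewrite lee_fin divr_ge0// pi_ge0.
by apply: expe_ge0; exact: ediam_ge0.
Qed.

Lemma hausdorff2_delta_ge0 delta A : 0 <= hausdorff2_delta delta A.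
Proof. by apply: le_ereal_inf_tmp => _ [C _ <-]; exact: nneseries_ge0. Qed.

Lemma hausdorff2_ge0 A : 0 <= hausdorff2 A.
Proof.
apply: (le_trans (hausdorff2_delta_ge0 1 A)).
by apply: ereal_sup_ubound; exists 1%R => //=.
Qed.

Lemma hausdorff2_0 : hausdorff2 set0 = 0.
Proof.
apply/eqP; rewrite eq_le hausdorff2_ge0 andbT.
apply: ge_ereal_sup => _ [delta /= d0 <-].
apply: ereal_inf_lbound; exists (fun=> set0).
  by split=> // i; rewrite ediam0 lee_fin ltW.
by rewrite eseries0// => i _ _; rewrite ediam0 expe2 !mule0.
Qed.

Lemma le_hausdorff2 : {homo hausdorff2 : A B / A `<=` B >-> A <= B}.
Proof.
move=> A B AB; apply: ge_ereal_sup => _ [delta d0 <-].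
apply: (@le_trans _ _ (hausdorff2_delta delta B)); last first.
  by apply: ereal_sup_ubound; exists delta.
apply: ereal_inf_le_tmp => _ [C [BC dC] <-]; exists C => //.
by split=> //; exact: subset_trans BC.
Qed.

Lemma hausdorff2_delta_sigma_subadditive delta :
  sigma_subadditive (hausdorff2_delta delta).
Proof.
move=> A; have [[i ioo]|] := pselect (exists i, hausdorff2_delta delta (A i) = +oo).
  rewrite (eseries_pinfty _ _ ioo) ?leey// => k _.
  by rewrite -ltNye (lt_le_trans _ (hausdorff2_delta_ge0 _ _)).
rewrite -forallNE => Aoo.
apply/lee_addgt0Pr => _/posnumP[e].
rewrite (le_trans _ (epsilon_trick _ _ _))//; last first.
  by move=> k; exact: hausdorff2_delta_ge0.
pose w (B : set 'rV[R]_n.+1) := (pi / 4)%R%:E * ediam B ^+ 2.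
have w0 B : 0 <= w B by exact: weight_ge0.
pose P k (B : (set 'rV[R]_n.+1)^nat) := hausdorff2_cover delta (A k) B /\
  \sum_(j <oo) w (B j) <=
    hausdorff2_delta delta (A k) + (e%:num / (2 ^ k.+1)%:R)%:E.
have [G PG] : {G : ((set 'rV[R]_n.+1)^nat)^nat & forall k, P k (G k)}.
  apply: (@choice _ _ P) => k; rewrite /P.
  have fA : hausdorff2_delta delta (A k) \is a fin_num.
    rewrite ge0_fin_numE ?hausdorff2_delta_ge0// ltey.
    by apply/eqP; exact: Aoo.
  have ek : (0 < e%:num / (2 ^ k.+1)%:R)%R by [].
  have [_ [B cB <-] lB] := lb_ereal_inf_adherent ek fA.
  by exists B; split => //; exact/ltW.
have wG0 x : 0 <= (w \o uncurry G) x by exact: w0.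
apply: (@le_trans _ _ (\esum_(i in setT) (w \o uncurry G) i)).
  apply: ereal_inf_lbound => /=.
  have /card_esym/ppcard_eqP[f] := card_nat2.
  exists (uncurry G \o f).
    split=> [t [k _ At]|i] /=.
      have [j _ Gt] := (PG k).1.1 _ At.
      by exists (f^-1%FUN (k, j)) => //=; rewrite invK ?inE.
    by case: (f i) => a b; exact: (PG a).1.2.
  rewrite -(esum_pred_image (w \o uncurry G) _ xpredT) ?[fun=> _]set_true//.
  by rewrite image_eq.
rewrite (_ : esum _ _ = \sum_(i <oo) \sum_(j <oo) w (G i j)); last first.
  pose J : nat -> set (nat * nat) := fun i => [set (i, j) | j in setT].
  rewrite (_ : setT = \bigcup_k J k); last first.
    by rewrite predeqE => -[a b]; split => // _; exists a => //; exists b.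
  rewrite esum_bigcupT //=; last first.
    apply/trivIsetP => i j _ _ ij.
    rewrite predeqE => -[k m] /=; split => //= -[] [_] _ [<-{k} _].
    by move=> [m' _] [] /esym/eqP; rewrite (negbTE ij).
  rewrite -(image_id [set: nat]) -fun_true esum_pred_image//; last first.
    by move=> k _; exact: esum_ge0.
  apply: eq_eseriesr => /= j _.
  rewrite -(esum_pred_image (w \o uncurry G) (pair j) predT)//=; last first.
    by move=> ? ? _ _; exact: (@can_inj _ _ _ snd).
  by congr esum; rewrite predeqE => -[a b]; split; move=> [i _ <-]; exists i.
apply: lee_lim.
- by apply: is_cvg_nneseries => k _ _; exact: nneseries_ge0.
- apply: is_cvg_nneseries => k _ _; apply: adde_ge0.
    exact: hausdorff2_delta_ge0.
  by rewrite lee_fin divr_ge0.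
- by near=> k; apply: lee_sum => i _; exact: (PG i).2.
Unshelve. all: by end_near. Qed.

Lemma hausdorff2_sigma_subadditive : sigma_subadditive hausdorff2.
Proof.
move=> A; apply: ge_ereal_sup => _ [delta d0 <-].
apply: (le_trans (hausdorff2_delta_sigma_subadditive delta A)).
apply: lee_nneseries => [i _ _|i _]; first exact: hausdorff2_delta_ge0.
by apply: ereal_sup_ubound; exists delta.
Qed.

HB.instance Definition _ := isOuterMeasure.Build R 'rV[R]_n.+1 hausdorff2
  hausdorff2_0 hausdorff2_ge0 le_hausdorff2 hausdorff2_sigma_subadditive.

End Hausdorff.

Definition hausdorff2_outer (R : realType) (n : nat) :
    {outer_measure set 'rV[R]_n.+1 -> \bar R} := @hausdorff2 R n.

(* The 2-dimensional Hausdorff measure of R^(n+1), on the sigma-algebra of all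
   Caratheodory measurable sets. *)
Definition H2 (R : realType) (n : nat) :
    {measure set (caratheodory_type (hausdorff2_outer R n)) -> \bar R} :=
  hausdorff2_outer R n : set (caratheodory_type (hausdorff2_outer R n)) -> \bar R.

(* Coordinatewise integral of a vector-valued function. *)
Definition vintegral (R : realType) (n k : nat) (D : set 'rV[R]_n.+1)
    (f : 'rV[R]_n.+1 -> 'rV[R]_k) : 'rV[R]_k :=
  \row_(i < k) \int[H2 R n]_(x in D) f x 0 i.

(* f is of class C^{k,1} (locally) on the open set V: the k-th derivatives are
   locally Lipschitz. *)
Fixpoint class_Ck1 (R : realType) (E F : normedModType R) (k : nat)
    (V : set E) (f : E -> F) : Prop :=
  if k is k'.+1 then
    (forall x, V x -> differentiable f x) /\
    (forall v : E, class_Ck1 k' V ('D_v f))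
  else
    forall x, V x -> exists2 W, nbhs x W & [lipschitz f y | y in W].

(* Embedded surface without boundary: every point has a neighbourhood in M that
   is the homeomorphic image of an open planar set under an immersion X of class
   C^{2,1}; Y is the chart inverse to X. *)
Definition C21_surface (R : realType) (M : set 'rV[R]_3) : Prop :=
  forall p, M p ->
  exists (U : set 'rV[R]_3) (V : set 'rV[R]_2)
         (X : 'rV[R]_2 -> 'rV[R]_3) (Y : 'rV[R]_3 -> 'rV[R]_2),
    [/\ open U /\ U p,
        open V /\ X @` V = M `&` U,
        class_Ck1 2 V X /\ (forall u, V u -> injective ('d X u)) &
        {within M `&` U, continuous Y} /\ (forall u, V u -> Y (X u) = u)].

(* Omega is a compact domain, i.e. the compact closure of a nonempty connected
   open set, and M is its boundary. *)
Definition bounds_compact_domain (R : realType) (M Omega : set 'rV[R]_3) :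
    Prop :=
  [/\ compact Omega, Omega° !=set0 /\ connected Omega°,
      closure Omega° = Omega & Omega `\` Omega° = M].

(* Velocities at p of curves running in M. *)
Definition tangent (R : realType) (M : set 'rV[R]_3) (p v : 'rV[R]_3) : Prop :=
  exists gamma : R -> 'rV[R]_3,
    [/\ gamma 0 = p, \forall t \near (0 : R), M (gamma t)
      & is_derive (0 : R) 1 gamma v].

Definition outward_unit_normal (R : realType) (M Omega : set 'rV[R]_3)
    (nu : 'rV[R]_3 -> 'rV[R]_3) : Prop :=
  {within M, continuous nu} /\
  forall p, M p ->
    [/\ sphere2 (nu p),
        forall v, tangent M p v -> dot (nu p) v = 0,
        \forall t \near (0 : R)^'+, ~ Omega (p + t *: nu p)
      & \forall t \near (0 : R)^'+, Omega (p - t *: nu p)].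

Definition E0 (R : realType) (M : set 'rV[R]_3) (nu : 'rV[R]_3 -> 'rV[R]_3)
    (n : 'rV[R]_3) : R :=
  \int[H2 R 2]_(w in M)
    (24 `^ 4^-1 * (1 - Num.sqrt (1 - dot (nu w) n ^+ 2))).

(* [is_derive] asserts that the derivative exists and has the given value. *)
Definition critical_point (R : realType) (E : 'rV[R]_3 -> R) (n : 'rV[R]_3) :
    Prop :=
  forall m, sphere2 m ->
    is_derive (0 : R) 1
      (fun t : R => E ((enorm (n + t *: m))^-1 *: (n + t *: m))) 0.

(* Main.v *)
(* For unit vectors, [1 - (nu.n)^2] is the squared norm of the projection of [n]
   to the plane orthogonal to [nu].  Writing [n_t = (n + t m) / |n + t m|], the
   energy is [c (|M| - G(t) / |n + t m|)] where [G(t)] integrates the norms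
   [sqrt (a + 2 t b + t^2 c)] of the projections of [n + t m].  These norms are
   Lipschitz in [t], so if [nu = +-n] only on a null set, dominated convergence
   gives [G'(0) = int b / sqrt a], and the derivative of the energy at [0] is
   [m] paired with the integral of the statement.  Conversely the second
   difference of the integrand at [0] is nonnegative by convexity, and equals
   [2 |t|] where [nu = +-n] when [m] is orthogonal to [n]; so differentiability
   of [G] at [0] forces the set [nu = +-n] to be null.
   All this requires [M] to have finite Hausdorff measure (local Lipschitz
   parametrizations and compactness) and closed sets to be measurable for the
   Hausdorff outer measure (Caratheodory's criterion). *)
Require Import Defs.
From mathcomp Require Import all_boot all_order all_algebra.
From mathcomp Require Import finmap ring lra.
From mathcomp Require Import all_classical all_reals all_analysis.
From mathcomp Require Import measurable_realfun.
Import Order.TTheory GRing.Theory Num.Theory.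
Import numFieldNormedType.Exports.
Local Open Scope classical_set_scope.
Local Open Scope ring_scope.

(** * Caratheodory's criterion for the Hausdorff measure *)

Section euclidean.
Context {R : realType} {n : nat}.
Implicit Types u v w : 'rV[R]_n.

Lemma dotC u v : dot u v = dot v u.
Proof. by apply: eq_bigr => i _; rewrite mulrC. Qed.

Lemma dotDl u v w : dot (u + v) w = dot u w + dot v w.
Proof. by rewrite -big_split; apply: eq_bigr => i _; rewrite mxE mulrDl. Qed.

Lemma dotZl a u v : dot (a *: u) v = a * dot u v.
Proof. by rewrite mulr_sumr; apply: eq_bigr => i _; rewrite mxE mulrA. Qed.

Lemma dotDr u v w : dot w (u + v) = dot w u + dot w v.
Proof. by rewrite dotC dotDl !(dotC w). Qed.

Lemma dotZr a u v : dot v (a *: u) = a * dot v u.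
Proof. by rewrite dotC dotZl dotC. Qed.

Lemma dotNl u v : dot (- u) v = - dot u v.
Proof. by rewrite -scaleN1r dotZl mulN1r. Qed.

Lemma dotNr u v : dot v (- u) = - dot v u.
Proof. by rewrite dotC dotNl dotC. Qed.

Lemma dot_ge0 u : 0 <= dot u u.
Proof. by apply: sumr_ge0 => i _; rewrite -expr2 sqr_ge0. Qed.

Lemma dot_eq0 u : dot u u = 0 -> u = 0.
Proof.
move=> /eqP; rewrite psumr_eq0 => [/allP u0|i _]; last by rewrite -expr2 sqr_ge0.
apply/rowP => i; have := u0 i (mem_index_enum i).
by rewrite mxE -expr2 sqrf_eq0 => /eqP.
Qed.

(** The squared norm of [dot v v *: u - dot u v *: v] is [dot v v] times the difference of the two
    sides. *)
Lemma cauchy_schwarz u v : dot u v ^+ 2 <= dot u u * dot v v.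
Proof.
have [/dot_eq0->|v0] := eqVneq (dot v v) 0.
  by rewrite -(scale0r u) !dotZr !mul0r expr0n mulr0.
have vv : 0 < dot v v by rewrite lt_def v0 dot_ge0.
have := dot_ge0 (dot v v *: u - dot u v *: v).
rewrite !(dotDl, dotDr, dotNl, dotNr, dotZl, dotZr) (dotC v u) => h.
have {}h : 0 <= dot v v * (dot u u * dot v v - dot u v ^+ 2).
  by move: h; congr (_ <= _); ring.
by rewrite -subr_ge0 -(pmulr_rge0 _ vv).
Qed.

Lemma enorm_ge0 u : 0 <= enorm u. Proof. exact: sqrtr_ge0. Qed.

Lemma sqr_enorm u : enorm u ^+ 2 = dot u u.
Proof. by rewrite sqr_sqrtr ?dot_ge0. Qed.

Lemma enormN u : enorm (- u) = enorm u.
Proof. by rewrite /enorm dotNl dotNr opprK. Qed.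

Lemma enorm_distC u v : enorm (u - v) = enorm (v - u).
Proof. by rewrite -enormN opprB. Qed.

Lemma enormD u v : enorm (u + v) <= enorm u + enorm v.
Proof.
rewrite -(@ler_pXn2r _ 2) ?nnegrE ?addr_ge0 ?enorm_ge0//.
rewrite sqrrD !sqr_enorm dotDl !dotDr (dotC v u).
suff : dot u v <= enorm u * enorm v by rewrite mulr2n; lra.
rewrite (le_trans (ler_norm _))// -(@ler_pXn2r _ 2) ?nnegrE ?mulr_ge0 ?enorm_ge0//.
by rewrite exprMn !sqr_enorm real_normK ?num_real// cauchy_schwarz.
Qed.

Lemma enorm_le_max (a : R) u : 0 <= a -> (forall i, `|u 0 i| <= a) ->
  enorm u <= n%:R * a.
Proof.
move=> a0 ua; rewrite -(@ler_pXn2r _ 2) ?nnegrE ?mulr_ge0 ?enorm_ge0//.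
rewrite sqr_enorm (@le_trans _ _ (n%:R * a ^+ 2))//.
  rewrite -[n in n%:R]card_ord -sum1_card natr_sum mulr_suml ler_sum// => i _.
  by rewrite mul1r -expr2 -real_normK ?num_real// ler_sqr ?nnegrE.
rewrite exprMn ler_wpM2r ?sqr_ge0// -natrX ler_nat.
by case: (n) => // k; rewrite expnS leq_pmulr.
Qed.

Lemma coord_le_enorm u i : `|u 0 i| <= enorm u.
Proof.
rewrite -(@ler_pXn2r _ 2) ?nnegrE ?enorm_ge0// real_normK ?num_real//.
rewrite sqr_enorm /dot (bigD1 i)//= -expr2 lerDl sumr_ge0// => j _.
by rewrite -expr2 sqr_ge0.
Qed.

End euclidean.

(** * Additivity on separated sets and measurability of closed sets *)

Section metric_outer_measure.
Local Open Scope ereal_scope.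
Context {R : realType} {n : nat}.
Implicit Types (A B F : set 'rV[R]_n.+1).

Let weight A := (pi / 4)%R%:E * ediam A ^+ 2.

Let weight_ge0 A : 0 <= weight A.
Proof.
apply: mule_ge0; first by rewrite lee_fin divr_ge0// pi_ge0.
by apply: expe_ge0; exact: ediam_ge0.
Qed.

Lemma le_ediam A B : A `<=` B -> ediam A <= ediam B.
Proof.
move=> AB; apply: ge_ereal_sup => _ [->|[x Ax [y Ay <-]]].
  exact: ediam_ge0.
by apply: ereal_sup_ubound; right; exists x; [exact: AB|exists y; [exact: AB|]].
Qed.

Let le_weight A B : A `<=` B -> weight A <= weight B.
Proof.
move=> AB; apply: lee_wpmul2l; first by rewrite lee_fin divr_ge0// pi_ge0.
by rewrite !expe2 lee_pmul ?ediam_ge0// le_ediam.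
Qed.

Let weight0 : weight set0 = 0.
Proof. by rewrite /weight ediam0 expe2 !mule0. Qed.

(** A set of diameter at most [delta < e] cannot meet both [A] and [B], so a cover of the union
    splits into covers of [A] and [B] without increasing the total weight. *)
Lemma hausdorff2_delta_setU_separated (e delta : R) A B : (delta < e)%R ->
  (forall x y, A x -> B y -> (e <= enorm (x - y))%R) ->
  hausdorff2_delta delta A + hausdorff2_delta delta B <=
  hausdorff2_delta delta (A `|` B).
Proof.
move=> de AB; apply: le_ereal_inf_tmp => _ [C [ABC dC] <-].
have dCI D i : ediam (C i `&` D) <= delta%:E.
  by apply: le_trans (dC i); apply: le_ediam; exact: subIsetl.
apply: (@le_trans _ _ (\sum_(i <oo) (weight (C i `&` A) + weight (C i `&` B)))).
  rewrite nneseriesD//; apply: leeD; apply: ereal_inf_lbound.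
    exists (fun i => C i `&` A) => //; split => // x Ax.
    by have [i _ Cx] := ABC x (or_introl Ax); exists i.
  exists (fun i => C i `&` B) => //; split => // x Ax.
  by have [i _ Cx] := ABC x (or_intror Ax); exists i.
apply: lee_nneseries => [i _ _|i _]; first by rewrite adde_ge0.
have [->|/set0P[x [Cx Ax]]] := eqVneq (C i `&` A) set0.
  by rewrite weight0 add0e; apply: le_weight; exact: subIsetl.
suff -> : C i `&` B = set0.
  by rewrite weight0 adde0; apply: le_weight; exact: subIsetl.
apply/seteqP; split => // y [Cy By].
have : (enorm (x - y))%:E <= delta%:E.
  apply: le_trans (dC i); apply: ereal_sup_ubound; right.
  by exists x => //; exists y.
by rewrite lee_fin => /(le_lt_trans)/(_ de); rewrite ltNge AB.
Qed.

Lemma le_hausdorff2_delta (d1 d2 : R) A : (d1 <= d2)%R ->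
  hausdorff2_delta d2 A <= hausdorff2_delta d1 A.
Proof.
move=> d12; apply: ereal_inf_le_tmp => _ [C [AC dC] <-]; exists C => //.
by split => // i; apply: le_trans (dC i) _; rewrite lee_fin.
Qed.

Lemma hausdorff2_setU_separated (e : R) A B : (0 < e)%R ->
  (forall x y, A x -> B y -> (e <= enorm (x - y))%R) ->
  hausdorff2 A + hausdorff2 B <= hausdorff2 (A `|` B).
Proof.
move=> e0 AB; have [->|fAB] := eqVneq (hausdorff2 (A `|` B)) +oo.
  exact: leey.
have finAB D : D `<=` A `|` B -> hausdorff2 D \is a fin_num.
  move=> DAB; rewrite ge0_fin_numE ?hausdorff2_ge0//.
  by rewrite (le_lt_trans (le_hausdorff2 DAB))// ltey.
(* Independent scales for [A] and [B] let the two suprema be taken one after the other. *)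
have key (d1 d2 : R) : (0 < d1)%R -> (0 < d2)%R ->
    hausdorff2_delta d1 A + hausdorff2_delta d2 B <= hausdorff2 (A `|` B).
  move=> d10 d20; pose d := Num.min (e / 2)%R (Num.min d1 d2).
  have d0 : (0 < d)%R by rewrite !lt_min d10 d20 divr_gt0.
  apply: (@le_trans _ _ (hausdorff2_delta d (A `|` B))); last first.
    by apply: ereal_sup_ubound; exists d.
  have de : (d < e)%R by rewrite (@le_lt_trans _ _ (e / 2)%R) ?ge_min ?lexx//; lra.
  apply: (le_trans _ (@hausdorff2_delta_setU_separated e d A B de AB)).
  by apply: leeD; apply: le_hausdorff2_delta; rewrite !ge_min lexx ?orbT.
have fB := finAB B (@subsetUr _ _ _).
rewrite -leeBrDr//.
apply: ge_ereal_sup => _ [d1 /= d10 <-].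
rewrite leeBrDr//.
have fA : hausdorff2_delta d1 A \is a fin_num.
  rewrite ge0_fin_numE ?hausdorff2_delta_ge0//.
  apply: le_lt_trans (_ : hausdorff2 A < +oo); last first.
    by rewrite ltey_eq finAB//; exact: subsetUl.
  by apply: ereal_sup_ubound; exists d1.
rewrite addeC -leeBrDr//.
apply: ge_ereal_sup => _ [d2 /= d20 <-].
by rewrite leeBrDr// addeC key.
Qed.

Let outer := hausdorff2_outer R n.

(* [S k] is the part of [A] at distance at least [1 / (k + 1)] from [F].  The
   shells [T k.+1] and [S k] are separated, so the outer measures of the shells
   sum to at most [2 outer A], and [A `\` F] is exhausted by the [S k] up to an
   arbitrarily small tail of shells. *)
Lemma closed_caratheodory_measurable F : closed F ->
  caratheodory_measurable outer F.
Proof.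
move=> cF; apply: le_caratheodory_measurable => A.
have [->|fA] := eqVneq (outer A) +oo; first exact: leey.
pose S k := [set x | A x /\ forall y, F y -> (k.+1%:R^-1 <= enorm (x - y))%R].
have SA k : S k `<=` A by move=> x [].
have Sgap k x y : S k x -> A y -> ~ S k.+1 y ->
    (k.+1%:R^-1 - k.+2%:R^-1 <= enorm (x - y) :> R)%R.
  move=> [Ax Sx] Ay /not_andP[//|/existsNP[z /not_implyP[Fz /negP]]].
  rewrite -ltNge => yz; have := Sx _ Fz.
  have -> : (x - z = (x - y) + (y - z))%R by rewrite addrA subrK.
  move: yz (enormD (x - y)%R (y - z)%R).
  by move: (enorm _) (enorm _) (enorm _) (_^-1)%R (_^-1)%R => *; lra.
have gap0 k : (0 < k.+1%:R^-1 - k.+2%:R^-1 :> R)%R.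
  by rewrite subr_gt0 ltf_pV2 ?posrE// ltr_nat.
pose T k := S k.+1 `\` S k.
have step k : outer (S k) + outer (T k.+1) <= outer (S k.+2).
  apply: (@le_trans _ _ (outer (S k `|` T k.+1))).
    apply: (@hausdorff2_setU_separated (k.+1%:R^-1 - k.+2%:R^-1)) => //.
    by move=> x y Sx [[Ay _] nSy]; exact: Sgap.
  apply: le_outer_measure => x [[Ax Sx]|[]//]; split => // y /Sx; apply: le_trans.
  by rewrite lef_pV2 ?posrE// ler_nat (leq_addl 2).
(* Even and odd shells telescope separately: [step] absorbs [T K.+1] into [S K.+2], hence the two
   consecutive terms on the right. *)
have tele K : outer (S 0%N) + outer (S 1%N) + \sum_(0 <= k < K) outer (T k.+1)
    <= outer (S K) + outer (S K.+1).
  elim: K => [|K IH]; first by rewrite big_geq// adde0.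
  rewrite big_nat_recr//= addeA.
  apply: (le_trans (leeD IH (lexx _))).
  by rewrite addeAC [X in _ <= X]addeC leeD// step.
have fT : \sum_(0 <= k <oo) outer (T k.+1) < +oo.
  apply: (@le_lt_trans _ _ (outer A + outer A)); last first.
    by rewrite lte_add_pinfty// ltey.
  apply: lime_le; first by apply: is_cvg_nneseries => k _ _; exact: outer_measure_ge0.
  apply: nearW => K.
  apply: (@le_trans _ _ (outer (S K) + outer (S K.+1))).
    by apply: le_trans (tele K); rewrite leeDr// adde_ge0// outer_measure_ge0.
  by apply: leeD; apply: le_outer_measure.
have ineq K : outer (A `&` F) + outer (A `&` ~` F) <=
    outer A + \sum_(K <= k <oo) outer (T k.+1).
  have h1 : outer (A `&` F) + outer (S K.+1) <= outer A.
    apply: (@le_trans _ _ (outer ((A `&` F) `|` S K.+1))); last first.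
      by apply: le_outer_measure => x [[]|[]].
    apply: (@hausdorff2_setU_separated K.+2%:R^-1) => //.
    by move=> x y [_ Fx] [_ Sy]; rewrite enorm_distC; exact: Sy.
  have h2 : outer (A `&` ~` F) <=
      outer (S K.+1) + \sum_(K <= k <oo) outer (T k.+1).
    apply: (@le_trans _ _ (outer (S K.+1 `|` \bigcup_(k in ~` `I_K) T k.+1))).
      apply: le_outer_measure => x [Ax nFx].
      (* As [F] is closed, a sup-norm ball of radius [e] around [x] misses it, and the Euclidean
         distance dominates the sup distance. *)
      have [N SN] : exists N, `[< S N x >].
        have : nbhs x (~` F) by apply: open_nbhs_nbhs; split => //; exact: closed_openC.
        move=> /nbhs_ballP[e /= e0 eF].
        exists (Num.truncn e^-1%R); apply/asboolP; split => // y Fy.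
        rewrite leNgt; apply/negP => xy; apply: (eF y) => //; split => // i j.
        rewrite (ord1 i) /ball/= .
        have := coord_le_enorm (x - y)%R j; rewrite !mxE => /le_lt_trans; apply.
        apply: (lt_trans xy); rewrite invf_plt ?posrE//.
        have e1 : (0 <= e^-1)%R by rewrite invr_ge0 ltW.
        by have /andP[] := truncn_itv e1.
      case: (@ex_minnP (fun N => `[< S N x >])); first by exists N.
      (* For the least [k] with [S k x], either [x] is in [S K.+1] by monotonicity, or it lies in
         the shell [T k.-1], the term of index [k.-2] in the shifted sum. *)
      move=> k /asboolP Sk kmin; have [kK|Kk] := leqP k K.+1.
        left; split => // y /Sk.2; apply: le_trans.
        by rewrite lef_pV2 ?posrE// ler_nat.
      right; exists k.-2; first by apply/negP; rewrite -leqNgt; case: (k) Kk => [|[]].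
      case: k Kk kmin Sk => [|[|k]]//= _ kmin Sk; split => // Sk'.
      by have := kmin k.+1 (asboolT Sk'); rewrite ltnn.
    apply: (le_trans (outer_measureU2 _ _ _)).
    by apply: leeD => //; exact: outer_measure_sigma_subadditive_tail.
  apply: (le_trans (leeD (lexx _) h2)).
  by rewrite addeA leeD.
have cv := @nneseries_tail_cvg _ (fun k => outer (T k.+1)) xpredT fT (fun k _ => outer_measure_ge0 _ _).
have : (outer A + \sum_(N <= k <oo) outer (T k.+1)) @[N --> \oo] --> outer A + 0.
  by apply: cvgeD => //; [rewrite fin_num_adde_defl|exact: cvg_cst].
rewrite adde0 => cvA; rewrite -(cvg_lim _ cvA)//.
by apply: lime_ge; [apply/cvg_ex; exists (outer A)|exact: nearW].
Qed.
End metric_outer_measure.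

(** * Finite area of Lipschitz squares *)

Section finite_area.
Context {R : realType}.

Lemma ediam_le (n : nat) (A : set 'rV[R]_n.+1) (d : R) : 0 <= d ->
  (forall x y, A x -> A y -> enorm (x - y) <= d) -> (ediam A <= d%:E)%E.
Proof.
move=> d0 Ad; apply: ge_ereal_sup => _ [->|[x Ax [y Ay <-]]].
  by rewrite lee_fin.
by rewrite lee_fin Ad.
Qed.

Lemma exists_unit_cell (N : nat) (t : R) : 0 <= t <= N.+1%:R ->
  exists2 i, (i < N.+1)%N & i%:R <= t <= i.+1%:R.
Proof.
move=> /andP[t0 tN]; have /andP[ti it] := truncn_itv t0.
have [iN|Ni] := ltnP (Num.truncn t) N.+1.
  by exists (Num.truncn t) => //; rewrite ti ltW.
(* Here [t] is the right endpoint [N.+1], which goes to the last cell. *)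
exists N => //; rewrite tN andbT.
by rewrite (le_trans _ ti)// ler_nat ltnW.
Qed.

Definition cube (m : nat) (u0 : 'rV[R]_m) (r : R) : set 'rV[R]_m :=
  [set u : 'rV[R]_m | forall i, `|u 0 i - u0 0 i| <= r].

(** Cutting the square into [N.+1 * N.+1] cells of side [h] gives images of diameter at most
    [L * h], whose total weight has a bound independent of the mesh. *)
Lemma hausdorff2_lipschitz_square (n : nat) (X : 'rV[R]_2 -> 'rV[R]_n.+1)
    (u0 : 'rV[R]_2) (r L : R) : 0 < r -> 0 < L ->
  (forall u v (d : R), cube _ u0 r u -> cube _ u0 r v ->
    (forall i, `|u 0 i - v 0 i| <= d) -> enorm (X u - X v) <= L * d) ->
  (hausdorff2 (X @` cube _ u0 r) < +oo)%E.
Proof.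
move=> r0 L0 lipX.
apply: (@le_lt_trans _ _ (pi / 4 * (L * (2 * r)) ^+ 2)%:E); last exact: ltry.
apply: ge_ereal_sup => _ [delta /= d0 <-].
(* Large enough that [L * h <= delta]. *)
pose N := Num.truncn (L * (2 * r) / delta).
have ND : L * (2 * r) / delta < N.+1%:R.
  have D0 : 0 <= L * (2 * r) / delta by rewrite divr_ge0 ?mulr_ge0// ltW.
  by have /andP[] := truncn_itv D0.
pose h := 2 * r / N.+1%:R.
have h0 : 0 < h by rewrite divr_gt0// mulr_gt0.
have hN : N.+1%:R * h = 2 * r by rewrite mulrC divfK.
have Lh : L * h <= delta.
  by rewrite mulrA ler_pdivrMr// -ler_pdivrMl// mulrC ltW.
pose cell (a : R) (k : nat) := [set t : R | a + k%:R * h <= t <= a + k.+1%:R * h].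
(* The index [k] encodes a pair of cell indices by quotient and remainder modulo [N.+1]. *)
pose S k := [set u : 'rV[R]_2 | [/\ cube _ u0 r u,
  cell (u0 0 0 - r) (k %/ N.+1)%N (u 0 0) & cell (u0 0 1 - r) (k %% N.+1)%N (u 0 1)]].
pose C k := if (k < N.+1 * N.+1)%N then X @` S k else set0.
have dC k : (ediam (C k) <= (L * h)%:E)%E.
  rewrite /C; case: ifPn => _; last by rewrite ediam0 lee_fin mulr_ge0// ltW.
  apply: ediam_le; first by rewrite mulr_ge0// ltW.
  move=> _ _ [u [Ku u0k u1k] <-] [v [Kv v0k v1k] <-]; apply: lipX => // i.
  have cellB a j s t : cell a j s -> cell a j t -> `|s - t| <= h.
    rewrite /cell/= -natr1 mulrDl mul1r ler_norml => /andP[? ?] /andP[? ?].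
    by apply/andP; split; lra.
  have [->|->] : i = 0 \/ i = 1.
    by case: i => [[|[|//]] ?]; [left|right]; apply: val_inj.
    exact: cellB u0k v0k.
  exact: cellB u1k v1k.
apply: (@le_trans _ _ (\sum_(i <oo) ((pi / 4)%:E * ediam (C i) ^+ 2))%E).
  apply: ereal_inf_lbound; exists C => //; split; last first.
    by move=> k; rewrite (le_trans (dC k))// lee_fin.
  move=> _ [u Ku <-].
  have ucell i : exists2 k, (k < N.+1)%N & cell (u0 0 i - r) k (u 0 i).
    have := Ku i; rewrite ler_norml => /andP[l1 l2].
    have [|k kN /andP[k1 k2]] := @exists_unit_cell N ((u 0 i - (u0 0 i - r)) / h).
      apply/andP; split; last by rewrite ler_pdivrMr// hN; lra.
      by apply: divr_ge0; [lra|exact: ltW].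
    exists k => //; rewrite /cell/=.
    move: k1 k2; rewrite ler_pdivlMr// ler_pdivrMr// => k1 k2.
    by apply/andP; split; lra.
  have [i iN ui] := ucell 0; have [j jN uj] := ucell 1.
  exists (i * N.+1 + j)%N => //; rewrite /C ifT; last first.
    by rewrite (@leq_trans (i.+1 * N.+1))// ?leq_mul2r ?iN ?orbT// mulSn addnC ltn_add2r.
  exists u => //; split => //.
    by rewrite divnMDl// divn_small// addn0.
  by rewrite modnMDl modn_small.
have w0 k : (0 <= (pi / 4)%:E * ediam (C k) ^+ 2)%E.
  by rewrite mule_ge0 ?expe_ge0 ?ediam_ge0// lee_fin divr_ge0// pi_ge0.
rewrite (nneseries_split 0%N (N.+1 * N.+1))// add0n.
rewrite [X in (_ + X)%E]eseries0 ?adde0; last first.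
  by move=> k Nk _; rewrite /C ifN -?leqNgt// ediam0 expe2 !mule0.
apply: (@le_trans _ _ (\sum_(0 <= k < N.+1 * N.+1) (pi / 4 * (L * h) ^+ 2)%:E)%E).
  apply: lee_sum => k _; rewrite [leRHS]EFinM lee_wpmul2l//.
    by rewrite lee_fin divr_ge0// pi_ge0.
  by rewrite expe2 expr2 [leRHS]EFinM lee_pmul ?ediam_ge0.
rewrite sumEFin lee_fin big_const_nat iter_addr_0 subn0 -[leLHS]mulr_natr natrM.
by rewrite -hN le_eqVlt; apply/orP; left; apply/eqP; ring.
Qed.

(** Continuity at [u0] bounds the partial derivatives on a small cube; the cube being convex, the
    mean value theorem on segments applies to each coordinate of [X]. *)
Lemma locally_lipschitz (m n : nat) (V : set 'rV[R]_m.+1)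
    (X : 'rV[R]_m.+1 -> 'rV[R]_n.+1) (u0 : 'rV[R]_m.+1) :
  open V -> V u0 -> (forall u, V u -> differentiable X u) ->
  (forall v, {for u0, continuous ('D_v X)}) ->
  exists r L, [/\ 0 < r, 0 < L, cube _ u0 r `<=` V &
    forall u v (d : R), cube _ u0 r u -> cube _ u0 r v ->
      (forall i, `|u 0 i - v 0 i| <= d) -> enorm (X u - X v) <= L * d].
Proof.
move=> oV Vu0 dX cX.
pose e (i : 'I_m.+1) : 'rV[R]_m.+1 := delta_mx 0 i.
pose B : R := 1 + \sum_i `|'D_(e i) X u0|.
have B0 : 0 < B by rewrite ltr_pwDl// sumr_ge0.
have : \forall u \near u0, V u /\ forall i, `|'D_(e i) X u| <= B.
  apply: filterI; first exact: open_nbhs_nbhs.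
  apply: (@filter_forall _ _ (fun i u => `|'D_(e i) X u| <= B) (nbhs u0)
    (nbhs_filter u0)) => i.
  have /cvgr_norm_lt : 'D_(e i) X u @[u --> u0] --> 'D_(e i) X u0 by exact: cX.
  move=> /(_ B) lt; apply: filterS (lt _) => [u|]; first exact: ltW.
  by rewrite /B (bigD1 i)//= addrCA ltrDl ltr_pwDl// sumr_ge0.
move=> /nbhs_ballP[r /= r0 rV].
(* Halving the radius puts the closed cube inside the open ball. *)
have cubeP u : cube _ u0 (r / 2) u -> V u /\ forall i, `|'D_(e i) X u| <= B.
  move=> Ku; apply: rV; split => // i j; rewrite (ord1 i) /ball/= distrC.
  by rewrite (le_lt_trans (Ku j))//; lra.
exists (r / 2), (n.+1%:R * (m.+1%:R * B)); split.
- by rewrite divr_gt0.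
- by rewrite !mulr_gt0.
- by move=> u /cubeP[].
move=> u v d Ku Kv uv; rewrite -mulrA; apply: enorm_le_max => [|j].
  by rewrite mulr_ge0 ?mulr_ge0 ?(le_trans _ (uv ord0))// ltW.
pose w (s : R) := v + s *: (u - v).
have Kw (s : R) : 0 <= s <= 1 -> cube _ u0 (r / 2) (w s).
  move=> /andP[s0 s1] i; rewrite !mxE.
  move: (Ku i) (Kv i); rewrite !ler_norml => /andP[? ?] /andP[? ?].
  by apply/andP; split; nra.
have dw (s : R) : 0 <= s <= 1 ->
    is_derive s 1 (fun s : R => X (w s) 0 j) ('D_(u - v) X (w s) 0 j).
  move=> /Kw/cubeP[Vw _]; have dXw : (fun h : R => h^-1 *: ((X \o shift (w s)) (h *: (u - v)) - X (w s))) @ 0^'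
      --> 'D_(u - v) X (w s).
    by apply: diff_derivable; exact: dX.
  suff cv : (fun h : R => h^-1 *: (((fun s : R => X (w s) 0 j) \o shift s) (h *: 1) - X (w s) 0 j))
      @ 0^' --> 'D_(u - v) X (w s) 0 j.
    by apply: DeriveDef; [apply/cvg_ex; exists ('D_(u - v) X (w s) 0 j)|exact: cvg_lim cv].
  have := cvg_comp _ _ dXw (@coord_continuous _ _ _ 0 j ('D_(u - v) X (w s))).
  apply: cvg_trans; apply: near_eq_cvg; apply: nearW => h /=.
  rewrite !mxE /w; congr (_ * (X _ 0 j - _)).
  by rewrite [h *: 1]mulr1 scalerDl addrCA.
have [s| |s s01 Xuv] := @MVT_segment R (fun s : R => X (w s) 0 j)
    (fun s => 'D_(u - v) X (w s) 0 j) 0 1 ler01.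
- by rewrite in_itv/= => /andP[s0 s1]; apply: dw; rewrite !ltW.
- apply: derivable_within_continuous => s; rewrite in_itv/= => s01.
  by have [] := dw s s01.
have [Vws Bws] := cubeP _ (Kw s s01).
have {Xuv} -> : (X u - X v) 0 j = 'D_(u - v) X (w s) 0 j.
  by move: Xuv; rewrite /w scale1r scale0r addr0 (addrC v) subrK !mxE subr0 mulr1.
rewrite deriveE; last exact: dX.
(* Expanding [u - v] in the standard basis brings in the bounded partial derivatives. *)
rewrite (row_sum_delta (u - v)) linear_sum summxE (le_trans (ler_norm_sum _ _ _))//.
rewrite (@le_trans _ _ (\sum_(i < m.+1) B * d))//; last first.
  by rewrite sumr_const card_ord -[leLHS]mulr_natl mulrA.
apply: ler_sum => i _; rewrite linearZ mxE normrM mulrC ler_pM//; last by rewrite !mxE.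
rewrite -deriveE; last exact: dX.
rewrite (le_trans _ (Bws i))// [leRHS]mx_normrE.
exact: (le_bigmax _ (fun ij => `|'D_(e i) X (w s) ij.1 ij.2|) (0, j)).
Qed.
End finite_area.

(** * Compact surfaces *)

Section surface.
Context {R : realType}.
Implicit Types M : set 'rV[R]_3.

Let outer := hausdorff2_outer R 2.

(** By continuity of the chart inverse [Y], points of [M] near [p] have parameters in a small cube,
    so they lie in a Lipschitz image of finite measure. *)
Lemma surface_locally_finite M p : C21_surface M -> M p ->
  exists W, [/\ open W, W p & (outer (M `&` W) < +oo)%E].
Proof.
move=> sM /[dup] Mp /sM[U [V [X [Y [[oU Up] [oV XV] [[dX cX] _] [cY YX]]]]]].
have [u0 Vu0 Xu0] : (X @` V) p by rewrite XV.
have [|r [L [r0 L0 KV lipX]]] := @locally_lipschitz R 1 2 V X u0 oV Vu0 dX.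
  by move=> v; apply: differentiable_continuous; apply: (cX v).1.
have fK := hausdorff2_lipschitz_square _ _ _ _ _ r0 L0 lipX.
have Yp : Y p = u0 by rewrite -Xu0 YX.
have : \forall q \near within (M `&` U) (nbhs p), cube 2 u0 r (Y q).
  rewrite (nbhs_subspace_in (A := M `&` U)); last by split.
  have : Y q @[q --> (p : subspace (M `&` U))] --> Y p by exact: cY.
  apply; rewrite Yp; apply/nbhs_ballP; exists r => //= u [_ ur] i.
  by rewrite distrC ltW// (ur 0 i).
move=> /nbhs_ballP[e /= e0 eK].
exists (U `&` ball p e); split.
- by apply: openI => //; exact: ball_open.
- by split => //; exact: ballxx.
apply: le_lt_trans fK; apply: le_hausdorff2 => q [Mq [Uq pq]].
have [u Vu Xu] : (X @` V) q by rewrite XV.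
by exists u => //; rewrite -(YX u Vu) Xu; apply: eK.
Qed.

Lemma compact_surface_finite M : C21_surface M -> compact M ->
  (outer M < +oo)%E.
Proof.
move=> sM; rewrite compact_cover => cM.
have [W HW] : {W : 'rV[R]_3 -> set 'rV[R]_3 & forall p, M p ->
    [/\ open (W p), W p p & (outer (M `&` W p) < +oo)%E]}.
  apply: (@choice _ _ (fun p W => M p -> [/\ open W, W p & (outer (M `&` W) < +oo)%E])) => p.
  have [Mp|nMp] := pselect (M p); last by exists set0.
  by have [W ?] := surface_locally_finite _ _ sM Mp; exists W.
have [||D DM MD] := cM _ M W.
- by move=> p /HW[].
- by move=> p Mp; exists p => //; have [] := HW p Mp.
suff : (outer (M `&` cover [set` D] W) < +oo)%E.
  by apply: le_lt_trans; apply: le_outer_measure => p Mp; split => //; exact: MD.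
have : {subset (D : seq _) <= M} by move=> p /DM.
rewrite (_ : [set` D] = [set` (D : seq _)])// /cover.
elim: (D : seq _) => [_|p s IH sM'].
  by rewrite (_ : _ `&` _ = set0) ?outer_measure0// -subset0 => x [_ []].
have Wps : M `&` \bigcup_(q in [set` p :: s]) W q `<=`
    (M `&` W p) `|` (M `&` \bigcup_(q in [set` s]) W q).
  move=> x [Mx [q /=]]; rewrite inE => /predU1P[->|qs] Wx; [by left|right].
  by split => //; exists q.
apply: le_lt_trans (le_outer_measure outer _ _ Wps) _.
apply: (le_lt_trans (outer_measureU2 _ _ _)).
apply: lte_add_pinfty.
  by have /set_mem/HW[] := sM' p (mem_head _ _).
by apply: IH => q qs; apply: sM'; rewrite inE qs orbT.
Qed.

Lemma open_cara_measurable (A : set 'rV[R]_3) : open A ->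
  measurable (A : set (caratheodory_type outer)).
Proof.
move=> oA; rewrite -(setCK A); apply: measurableC.
exact: closed_caratheodory_measurable (open_closedC oA).
Qed.

Lemma compact_cara_measurable (A : set 'rV[R]_3) : compact A ->
  measurable (A : set (caratheodory_type outer)).
Proof.
move=> cA; apply: closed_caratheodory_measurable.
exact: compact_closed (@norm_hausdorff _ _) cA.
Qed.

Lemma continuous_cara_measurable M (f : 'rV[R]_3 -> R) :
  measurable (M : set (caratheodory_type outer)) -> {within M, continuous f} ->
  measurable_fun (M : set (caratheodory_type outer)) f.
Proof.
move=> mM /continuousP cf.
apply: (measurability _ (RGenOpens.measurableE R)).
move=> _ [_ [a [b ->] <-]].
have /cf/open_subspaceP[W oW WM] : open `]a, b[%classic by exact: interval_open.
rewrite setIC -WM; apply: measurableI => //; exact: open_cara_measurable.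
Qed.
End surface.

(** * Integrals of square roots of quadratics *)

Section sqrt_quadratic.
Context {R : realType}.
Implicit Types a b c t : R.

Lemma is_derive0P (f : R -> R) (l : R) :
  is_derive (0 : R) 1 f l <-> h^-1 * (f h - f 0) @[h --> 0^'] --> l.
Proof.
have -> : (fun h : R => h^-1 * (f h - f 0)) =
    (fun h : R => h^-1 *: ((f \o shift 0) (h *: 1) - f 0)).
  by apply/funext => h /=; rewrite addr0 [h *: 1]mulr1.
split => [[df <-]//|fl].
by apply: DeriveDef; [apply/cvg_ex; exists l|exact: cvg_lim fl].
Qed.

(* The norm of [u + t v], where [a], [b] and [c] are the inner products
   [u.u], [u.v] and [v.v]. *)
Definition qsqrt a b c t := Num.sqrt (a + 2 * t * b + t ^+ 2 * c).

Lemma qsqrt0 a b c : qsqrt a b c 0 = Num.sqrt a.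
Proof. by rewrite /qsqrt mulr0 mul0r expr0n mul0r !addr0. Qed.

Lemma quadratic_ge0 a b c t : 0 <= a -> 0 <= c -> b ^+ 2 <= a * c ->
  0 <= a + 2 * t * b + t ^+ 2 * c.
Proof.
move=> a0 c0 bac; have [c00|cn0] := eqVneq c 0.
  move: bac; rewrite c00 mulr0 => b2.
  have -> : b = 0 by apply/eqP; rewrite -sqrf_eq0 eq_le b2 sqr_ge0.
  by rewrite !mulr0 !addr0.
have c1 : 0 < c by rewrite lt_def cn0.
rewrite -(pmulr_rge0 _ c1).
(* [c] times the quadratic is [(b + t * c) ^+ 2 + (a * c - b ^+ 2)]. *)
have := sqr_ge0 (b + t * c); nra.
Qed.

(** Triangle inequality for [u + t v], with [b ^+ 2 <= a * c] in the role of Cauchy-Schwarz. *)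
Lemma qsqrt_le a b c t : 0 <= a -> 0 <= c -> b ^+ 2 <= a * c ->
  qsqrt a b c t <= Num.sqrt a + `|t| * Num.sqrt c.
Proof.
move=> a0 c0 bac; have r0 : 0 <= Num.sqrt a + `|t| * Num.sqrt c.
  by rewrite addr_ge0 ?mulr_ge0 ?sqrtr_ge0.
rewrite -(ger0_norm r0) -sqrtr_sqr ler_wsqrtr// sqrrD exprMn !sqr_sqrtr//.
rewrite real_normK ?num_real// lerD2r lerD2l.
rewrite (le_trans (ler_norm _))// !normrM (ger0_norm (ler0n _ 2)) -[leRHS]mulr_natl -mulrA ler_wpM2l//.
rewrite mulrCA ler_wpM2l// -sqrtr_sqr -sqrtrM// ler_wsqrtr//.
Qed.

Lemma qsqrt_dist a b c t : 0 <= a -> 0 <= c -> b ^+ 2 <= a * c ->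
  `|qsqrt a b c t - Num.sqrt a| <= `|t| * Num.sqrt c.
Proof.
move=> a0 c0 bac; have := qsqrt_le a b c t a0 c0 bac.
have q0 := quadratic_ge0 a b c t a0 c0 bac.
(* The opposite bound is [qsqrt_le] for the step from [u + t v] back to [u]. *)
have := qsqrt_le _ (- (b + t * c)) c t q0 c0; rewrite {1}/qsqrt.
have -> : a + 2 * t * b + t ^+ 2 * c + 2 * t * - (b + t * c) + t ^+ 2 * c = a by ring.
have h : (- (b + t * c)) ^+ 2 <= (a + 2 * t * b + t ^+ 2 * c) * c by nra.
move=> /(_ h) h1 h2; rewrite ler_norml; apply/andP; split; rewrite /qsqrt in h2 *; lra.
Qed.

(** Convexity of the norm along a line. The product of the two quadratics is [(a + t ^+ 2 * c) ^+ 2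
    - 4 * t ^+ 2 * b ^+ 2], which is at least [(a - t ^+ 2 * c) ^+ 2]. *)
Lemma qsqrt_midpoint a b c t : 0 <= a -> 0 <= c -> b ^+ 2 <= a * c ->
  2 * Num.sqrt a <= qsqrt a b c t + qsqrt a b c (- t).
Proof.
move=> a0 c0 bac.
have q1 := quadratic_ge0 a b c t a0 c0 bac.
have q2 := quadratic_ge0 a b c (- t) a0 c0 bac.
rewrite -(@ler_pXn2r _ 2) ?nnegrE ?addr_ge0 ?mulr_ge0 ?sqrtr_ge0//.
rewrite sqrrD exprMn !sqr_sqrtr// -sqrtrM//.
suff : a - t ^+ 2 * c <= Num.sqrt
  ((a + 2 * t * b + t ^+ 2 * c) * (a + 2 * - t * b + (- t) ^+ 2 * c)).
  by rewrite sqrrN -[Num.sqrt _ *+ 2]mulr_natl; lra.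
rewrite (le_trans (ler_norm _))// -sqrtr_sqr ler_wsqrtr//.
have := ler_wpM2l (sqr_ge0 t) bac; rewrite sqrrN; lra.
Qed.

Lemma is_derive_qsqrt a b c : 0 < a ->
  is_derive (0 : R) 1 (qsqrt a b c) (b / Num.sqrt a).
Proof.
move=> a0; pose q t := a + 2 * t * b + t ^+ 2 * c.
have q0 : q 0 = a by rewrite /q mulr0 mul0r expr0n mul0r !addr0.
have dq : is_derive (0 : R) 1 q (2 * b).
  apply/is_derive0P; rewrite q0.
  have : 2 * b + h * c @[h --> (0 : R)^'] --> 2 * b + 0 * c.
    apply: cvgD; first exact: cvg_cst.
    by apply: cvgMl; apply: cvg_within; exact: cvg_id.
  rewrite mul0r addr0; apply: cvg_trans; apply: near_eq_cvg.
  by near=> h; rewrite /q; field; near: h; exact: nbhs_dnbhs_neq.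
have ds : is_derive (q 0) 1 Num.sqrt (2 * Num.sqrt (q 0))^-1.
  by apply: is_derive1_sqrt; rewrite q0.
have := is_derive1_comp (f := Num.sqrt) (g := q) ds dq.
congr (is_derive _ _ _ _); rewrite q0.
by field; rewrite gt_eqF// sqrtr_gt0.
Unshelve. all: by end_near. Qed.
End sqrt_quadratic.

(** * Differentiability at 0 of the integral of [qsqrt] *)

Section integral_qsqrt.
Context d (T : measurableType d) (R : realType).
Variables (mu : {measure set T -> \bar R}) (D : set T) (A B C : T -> R) (k : R).
Hypotheses (mD : measurable D) (fD : (mu D < +oo)%E).
Hypotheses (mA : measurable_fun D A) (mB : measurable_fun D B)
  (mC : measurable_fun D C).
Hypotheses (A0 : forall w, D w -> 0 <= A w) (C0 : forall w, D w -> 0 <= C w)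
  (BAC : forall w, D w -> B w ^+ 2 <= A w * C w)
  (Ak : forall w, D w -> A w <= k) (Ck : forall w, D w -> C w <= k).

Lemma bounded_integrable (f : T -> R) (b : R) : measurable_fun D f ->
  (forall w, D w -> `|f w| <= b) -> mu.-integrable D (EFin \o f).
Proof.
move=> mf fb; apply: measurable_bounded_integrable => //.
exists b; split; first exact: num_real.
by move=> x bx w Dw; exact: le_trans (fb w Dw) (ltW bx).
Qed.

Lemma measurable_sqrt (f : T -> R) : measurable_fun D f ->
  measurable_fun D (fun w => Num.sqrt (f w)).
Proof.
apply: measurableT_comp; apply: continuous_measurable_fun.
exact: sqrt_continuous.
Qed.

(** For nonnegative values the inverse is the power with exponent -1, both being 0 at 0. *)
Lemma measurable_inv (f : T -> R) : measurable_fun D f ->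
  (forall w, D w -> 0 <= f w) -> measurable_fun D (fun w => (f w)^-1).
Proof.
move=> mf f0; apply: (eq_measurable_fun (fun w => f w `^ (-1))).
  by move=> w /set_mem/f0; exact: powR_inv1.
exact: (measurableT_comp (measurable_powR (-1)) mf).
Qed.

Let h t w := qsqrt (A w) (B w) (C w) t.

Lemma measurable_qsqrt t : measurable_fun D (h t).
Proof.
apply: measurable_sqrt; apply: measurable_funD.
  apply: measurable_funD => //; apply: measurable_funM => //.
by apply: measurable_funM.
Qed.

Lemma integrable_qsqrt t : mu.-integrable D (EFin \o h t).
Proof.
apply: (bounded_integrable _ (Num.sqrt k + `|t| * Num.sqrt k)).
  exact: measurable_qsqrt.
move=> w Dw; rewrite ger0_norm ?sqrtr_ge0//.
rewrite (le_trans (qsqrt_le _ _ _ _ (A0 w Dw) (C0 w Dw) (BAC w Dw)))//.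
by rewrite lerD ?ler_wpM2l// ler_wsqrtr ?Ak ?Ck.
Qed.

Let G t := \int[mu]_(w in D) h t w.

Lemma measurable_ratio : measurable_fun D (fun w => B w / Num.sqrt (A w)).
Proof.
apply: measurable_funM => //; apply: measurable_inv; first exact: measurable_sqrt.
by move=> w _; exact: sqrtr_ge0.
Qed.

Lemma integrable_ratio :
  mu.-integrable D (EFin \o (fun w => B w / Num.sqrt (A w))).
Proof.
apply: (bounded_integrable _ (Num.sqrt k)); first exact: measurable_ratio.
(* Where [A w] vanishes the ratio is 0 by convention; elsewhere [BAC] bounds it by the root of
   [C w]. *)
move=> w Dw; have [A00|An0] := eqVneq (Num.sqrt (A w)) 0.
  by rewrite A00 invr0 mulr0 normr0 sqrtr_ge0.
have sA : 0 < Num.sqrt (A w) by rewrite lt_def An0 sqrtr_ge0.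
rewrite normrM normfV (gtr0_norm sA) ler_pdivrMr// -sqrtr_sqr -sqrtrM; last first.
  by rewrite (le_trans (C0 w Dw))// Ck.
rewrite ler_wsqrtr// (le_trans (BAC w Dw))// mulrC ler_wpM2r ?A0 ?Ck//.
Qed.

(** Dominated convergence along sequences tending to 0: the difference quotients are bounded by
    [Num.sqrt k] and converge wherever [A w != 0]. *)
Lemma is_derive_integral_qsqrt : {ae mu, forall w, D w -> A w != 0} ->
  is_derive (0 : R) 1 G (\int[mu]_(w in D) (B w / Num.sqrt (A w))).
Proof.
move=> An0; apply/is_derive0P/cvgr_dnbhsP => u [un0 u0].
pose f_ n w := (u n)^-1 * (h (u n) w - h 0 w).
have mf_ n : measurable_fun D (f_ n).
  by apply: measurable_funM => //; apply: measurable_funB; exact: measurable_qsqrt.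
have f_k n w : D w -> `|f_ n w| <= Num.sqrt k.
  move=> Dw; rewrite normrM normfV ler_pdivrMl ?normr_gt0// /h qsqrt0.
  rewrite (le_trans (qsqrt_dist _ _ _ _ (A0 w Dw) (C0 w Dw) (BAC w Dw)))//.
  by rewrite ler_wpM2l// ler_wsqrtr ?Ck.
have [] := @dominated_convergence _ _ _ mu D mD (fun n => EFin \o f_ n)
  (EFin \o (fun w => B w / Num.sqrt (A w))) (cst (Num.sqrt k)%:E).
- by move=> n; apply/measurable_EFinP.
- exact/measurable_EFinP/measurable_ratio.
- move: An0; apply: filterS => w /= An0 Dw; apply: cvg_EFin; first exact: nearW.
  have /is_derive0P/cvgr_dnbhsP : is_derive (0 : R) 1 (qsqrt (A w) (B w) (C w))
      (B w / Num.sqrt (A w)).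
    by apply: is_derive_qsqrt; rewrite lt_def An0// A0.
  exact.
- apply: (bounded_integrable (cst (Num.sqrt k)) (Num.sqrt k)) => //.
  by move=> w _; rewrite ger0_norm// sqrtr_ge0.
- by apply: aeW => w n Dw; rewrite lee_fin f_k.
move=> iBA _ cv.
have -> : (fun n => (u n)^-1 * (G (u n) - G 0)) =
    (fun n => fine (\int[mu]_(w in D) (EFin \o f_ n) w)%E).
  apply/funext => n; rewrite -RintegralB//; [|exact: integrable_qsqrt..].
  rewrite -RintegralZl//.
  by have := integrableB mD (integrable_qsqrt (u n)) (integrable_qsqrt 0).
apply: fine_cvg; rewrite fineK//; exact: integrable_fin_num.
Qed.

(** On [Z] the integrand is [|t|], and elsewhere its second difference is nonnegative. So the second
    difference of [G] is at least [2 * t * mu Z], whereas differentiability makes it o(t). *)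
Lemma derivable_integral_qsqrt_null :
  (forall w, D w -> A w = 0 -> C w = 1) -> derivable G 0 1 ->
  mu (D `&` [set w | A w = 0]) = 0%E.
Proof.
move=> C1 dG; set Z := D `&` _.
have mZ : measurable Z by exact: mA mD _ (measurable_set1 0).
have fZ : (mu Z < +oo)%E.
  by apply: le_lt_trans fD; apply: le_measure; rewrite ?inE//; exact: subIsetl.
have key t : 0 < t -> 2 * t * fine (mu Z) <= G t + G (- t) - 2 * G 0.
  move=> t0.
  have i1 : mu.-integrable D (EFin \o \1_Z).
    apply: (bounded_integrable _ 1); first exact: measurable_indic.
    by move=> w _; rewrite indicE ger0_norm// lern1 leq_b1.
  have -> : fine (mu Z) = \int[mu]_(w in D) \1_Z w.
    by rewrite /Rintegral integral_indic// /Z setIAC setIid.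
  have i0 : mu.-integrable D (EFin \o (fun w => 2 * h 0 w)).
    by have := integrableZl mD 2 (integrable_qsqrt 0).
  have ipm : mu.-integrable D (EFin \o (fun w => h t w + h (- t) w)).
    by have := integrableD mD (integrable_qsqrt t) (integrable_qsqrt (- t)).
  rewrite -RintegralZl// -(RintegralZl _ mD (integrable_qsqrt 0)).
  rewrite -RintegralD//; [|exact: integrable_qsqrt..].
  rewrite -RintegralB//; apply: le_Rintegral => //.
  - by have := integrableZl mD (2 * t) i1.
  - by have := integrableB mD ipm i0.
  move=> w Dw; rewrite indicE; have [/set_mem[_ /= Aw]|_] := boolP (w \in Z).
    have Bw : B w = 0.
      apply/eqP; rewrite -sqrf_eq0 eq_le sqr_ge0 andbT.
      by rewrite (le_trans (BAC w Dw))// Aw mul0r.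
    rewrite /h /qsqrt Aw Bw (C1 w Dw Aw) !mulr0 !mulr1 !add0r sqrrN !sqrtr_sqr.
    by rewrite normr0 gtr0_norm//; lra.
  rewrite mulr0 subr_ge0 {1}/h qsqrt0.
  exact: qsqrt_midpoint (A0 w Dw) (C0 w Dw) (BAC w Dw).
have /is_derive0P/cvgr_dist_lt cvG : is_derive (0 : R) 1 G ('D_1 G 0) by exact: derivableP.
have [//|Z0] := eqVneq (mu Z) 0%E.
have m0 : 0 < fine (mu Z) by rewrite fine_gt0// fZ andbT lt0e Z0 measure_ge0.
(* With tolerance [fine (mu Z)], subtracting the quotients at [e / 2] and [- (e / 2)] cancels the
   derivative and leaves less than the [2 * fine (mu Z)] that [key] requires. *)
have /nbhs_ballP[e /= e0 eG] := cvG _ m0.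
have e2 : 0 < e / 2 by rewrite divr_gt0.
have e2n := gt_eqF e2.
have := eG (e / 2); have := eG (- (e / 2)).
rewrite /ball/= !sub0r !normrN gtr0_norm// oppr_eq0 e2n/=.
have -> : e / 2 < e by lra.
move=> /(_ isT isT) + /(_ isT isT); rewrite !ltr_norml => /andP[_ h1] /andP[h2 _].
move: h1 h2 (key _ e2); rewrite invrN mulNr opprK => h1 h2 h3.
have : (e / 2)^-1 * (G (e / 2) + G (- (e / 2)) - 2 * G 0) < 2 * fine (mu Z).
  by move: h1 h2; move: (_^-1) (fine _) ('D_1 G 0) => *; lra.
by rewrite ltr_pdivrMl// => h4; move: h3; rewrite leNgt [2 * (e / 2)]mulrC -mulrA h4.
Qed.
End integral_qsqrt.

(** * The energy *)

Lemma exists_unit_orthogonal (R : realType) (n : 'rV[R]_3) :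
  exists2 m, sphere2 m & dot n m = 0.
Proof.
suff [v v0 nv] : exists2 v : 'rV[R]_3, dot v v != 0 & dot n v = 0.
  exists ((enorm v)^-1 *: v); last by rewrite dotZr nv mulr0.
  have Nv : enorm v != 0 by rewrite -sqrf_eq0 sqr_enorm.
  rewrite /sphere2/= {1}/enorm dotZl dotZr mulrA -sqr_enorm -expr2 -exprMn.
  by rewrite mulVf// expr1n sqrtr1.
have dot3 (u v : 'rV[R]_3) : dot u v = u 0 0 * v 0 0 + (u 0 1 * v 0 1 + u 0 2 * v 0 2).
  rewrite /dot !big_ord_recl big_ord0 addr0.
  by congr (u _ _ * v _ _ + (u _ _ * v _ _ + u _ _ * v _ _)); exact: val_inj.
(* Either [n] lies on the third axis, or its first two coordinates are rotated by a right angle. *)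
have [n0|n0] := eqVneq (n 0 0 ^+ 2 + n 0 1 ^+ 2) 0.
  exists (delta_mx 0 0); rewrite dot3 !mxE/=.
    by rewrite !mulr0 !addr0 mulr1 oner_neq0.
  move: n0 => /eqP; rewrite paddr_eq0 ?sqr_ge0// !sqrf_eq0 => /andP[/eqP-> _].
  by rewrite mul0r !mulr0 !addr0.
exists (\row_i (if i == 0 then n 0 1 else if i == 1 then - n 0 0 else 0)).
  by rewrite dot3 !mxE/= mulr0 addr0 mulrNN -!expr2 addrC.
by rewrite dot3 !mxE/= mulr0 addr0 mulrN [n 0 1 * _]mulrC subrr.
Qed.

Section energy.
Context {R : realType}.
Variables (M : set 'rV[R]_3) (nu : 'rV[R]_3 -> 'rV[R]_3) (n : 'rV[R]_3).
Hypotheses (M_surface : C21_surface M) (M_compact : compact M)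
  (nu_cont : {within M, continuous nu}) (nu1 : forall w, M w -> sphere2 (nu w))
  (n1 : sphere2 n).

Let mu := H2 R 2.
Let D : set (caratheodory_type (hausdorff2_outer R 2)) := M.

Lemma sphere2_dot (u : 'rV[R]_3) : sphere2 u -> dot u u = 1.
Proof. by move=> u1; rewrite -sqr_enorm u1 expr1n. Qed.

Lemma measurable_surface : measurable D.
Proof. exact: compact_cara_measurable. Qed.

Lemma surface_finite : (mu D < +oo)%E.
Proof. exact: compact_surface_finite. Qed.

Lemma measurable_normal_coord i : measurable_fun D (fun w => nu w 0 i).
Proof.
apply: continuous_cara_measurable; first exact: measurable_surface.
apply: (@within_continuous_comp _ _ _ M nu (fun u : 'rV[R]_3 => u 0 i)) => //.
by move=> u _; exact: coord_continuous.
Qed.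

Lemma measurable_dot_normal v : measurable_fun D (fun w => dot (nu w) v).
Proof.
rewrite /dot; apply: (@measurable_sum _ _ R D 'I_3 (index_enum 'I_3)
  (fun i w => nu w 0 i * v 0 i)) => i.
by apply: measurable_funM; [exact: measurable_normal_coord|exact: measurable_cst].
Qed.

(** For unit vectors, [A], [B m] and [C m] are the inner products of the projections of [n] and [m]
    to the plane orthogonal to [nu w]; [BAC] is their Cauchy-Schwarz inequality. *)
Let A w := 1 - dot (nu w) n ^+ 2.
Let B m w := dot n m - dot (nu w) n * dot (nu w) m.
Let C m w := 1 - dot (nu w) m ^+ 2.

Let measurable_A : measurable_fun D A.
Proof.
apply: measurable_funB; first exact: measurable_cst.
by apply: measurable_funX; exact: measurable_dot_normal.
Qed.

Let measurable_B m : measurable_fun D (B m).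
Proof.
apply: measurable_funB; first exact: measurable_cst.
by apply: measurable_funM; exact: measurable_dot_normal.
Qed.

Let measurable_C m : measurable_fun D (C m).
Proof.
apply: measurable_funB; first exact: measurable_cst.
by apply: measurable_funX; exact: measurable_dot_normal.
Qed.

Let C_ge0 m : sphere2 m -> forall w, D w -> 0 <= C m w.
Proof.
move=> m1 w /nu1 nw1; rewrite subr_ge0 (le_trans (cauchy_schwarz _ _))//.
by rewrite !sphere2_dot// mulr1.
Qed.

Let C_le1 m w : D w -> C m w <= 1.
Proof. by move=> _; rewrite gerBl sqr_ge0. Qed.

Let BAC m : sphere2 m -> forall w, D w -> B m w ^+ 2 <= A w * C m w.
Proof.
move=> m1 w /nu1/sphere2_dot nw1.
have := cauchy_schwarz (n - dot (nu w) n *: nu w) (m - dot (nu w) m *: nu w).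
rewrite !(dotDl, dotDr, dotNl, dotNr, dotZl, dotZr) nw1 !sphere2_dot//.
rewrite (dotC n (nu w)) (dotC m (nu w)).
by congr (_ ^+ 2 <= _ * _); rewrite /A /B /C; ring.
Qed.

Let G m t := \int[mu]_(w in D) qsqrt (A w) (B m w) (C m w) t.

Let integrable_perimeter m t : sphere2 m ->
  mu.-integrable D (EFin \o (fun w => qsqrt (A w) (B m w) (C m w) t)).
Proof.
move=> m1.
(* [C n] is [A], so the bounds on [C] at [n] serve for [A]. *)
exact: (integrable_qsqrt _ _ _ mu D A (B m) (C m) 1 measurable_surface
  surface_finite measurable_A (measurable_B m) (measurable_C m) (C_ge0 n n1)
  (C_ge0 m m1) (BAC m m1) (C_le1 n) (C_le1 m) t).
Qed.

Let c : R := 24 `^ 4^-1.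

Let c_neq0 : c != 0.
Proof. by rewrite gt_eqF// powR_gt0. Qed.

Let perturbed m t := (enorm (n + t *: m))^-1 *: (n + t *: m).

Lemma enorm_perturbed m t : sphere2 m -> enorm (n + t *: m) = qsqrt 1 (dot n m) 1 t.
Proof.
move=> m1; rewrite /enorm /qsqrt !(dotDl, dotDr, dotZl, dotZr) !sphere2_dot//.
by rewrite (dotC m n); congr (Num.sqrt _); ring.
Qed.

(** With [N] the norm of [n + t *: m], the radicand is [N^-1 ^+ 2] times
    [N ^+ 2 - dot (nu w) (n + t *: m) ^+ 2], the squared norm of the projection. *)
Lemma E0_perturbed m t : sphere2 m -> 0 < enorm (n + t *: m) ->
  E0 M nu (perturbed m t) = c * (fine (mu D) - (enorm (n + t *: m))^-1 * G m t).
Proof.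
move=> m1; set N := enorm _ => N0.
have N2 : N ^+ 2 = 1 + 2 * t * dot n m + t ^+ 2.
  rewrite sqr_enorm !(dotDl, dotDr, dotZl, dotZr) !sphere2_dot// (dotC m n).
  by ring.
have iq := integrable_perimeter m t m1.
have i1 : mu.-integrable D (EFin \o (fun w => N^-1 * qsqrt (A w) (B m w) (C m w) t)).
  by have := integrableZl measurable_surface N^-1 iq.
have ic : mu.-integrable D (EFin \o cst 1).
  apply: (bounded_integrable _ _ _ _ _ _ _ _ 1) => //.
  - exact: measurable_surface.
  - exact: surface_finite.
  by move=> w _; rewrite normr1.
rewrite /G -RintegralZl//; last exact: measurable_surface.
rewrite -[fine _]mul1r -Rintegral_cst; last exact: measurable_surface.
rewrite -RintegralB//; last exact: measurable_surface.
rewrite -RintegralZl//; last 2 first.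
- exact: measurable_surface.
- by have := integrableB measurable_surface ic i1.
apply: eq_Rintegral => w /set_mem/nu1/sphere2_dot nw1.
congr (_ * (_ - _)); rewrite dotZr -/N.
have -> : 1 - (N^-1 * dot (nu w) (n + t *: m)) ^+ 2 =
    N^-1 ^+ 2 * (A w + 2 * t * B m w + t ^+ 2 * C m w).
  have -> : A w + 2 * t * B m w + t ^+ 2 * C m w = N ^+ 2 - dot (nu w) (n + t *: m) ^+ 2.
    by rewrite N2 dotDr dotZr /A /B /C; ring.
  by field; rewrite gt_eqF.
by rewrite sqrtrM ?sqr_ge0// sqrtr_sqr ger0_norm// invr_ge0 ltW.
Qed.

Let derivable_perimeter_null m : sphere2 m -> dot n m = 0 ->
  derivable (G m) 0 1 -> mu (D `&` [set w | A w = 0]) = 0%E.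
Proof.
move=> m1 nm dG.
apply: (derivable_integral_qsqrt_null _ _ _ mu D A (B m) (C m) 1 measurable_surface
  surface_finite measurable_A (measurable_B m) (measurable_C m) (C_ge0 n n1)
  (C_ge0 m m1) (BAC m m1) (C_le1 n) (C_le1 m) _ dG) => w Dw Aw.
(* Where [A w = 0], the product [dot (nu w) n] squares to 1, so [BAC] forces [dot (nu w) m = 0]. *)
have := BAC m m1 w Dw; rewrite Aw mul0r /B nm sub0r sqrrN exprMn.
have -> : dot (nu w) n ^+ 2 = 1 by move: Aw; rewrite /A; lra.
rewrite mul1r => y0; rewrite /C.
have -> : dot (nu w) m ^+ 2 = 0 by apply/eqP; rewrite eq_le y0 sqr_ge0.
by rewrite subr0.
Qed.

Let perturbed_near m : sphere2 m -> \forall t \near 0, 0 < enorm (n + t *: m).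
Proof.
move=> m1; near=> t; have t1 : `|t| < 1.
  by near: t; apply/nbhs_ballP; exists 1 => //= t; rewrite /ball/= sub0r normrN.
have := enormD (n + t *: m) (- (t *: m)); rewrite addrK enormN n1.
have -> : enorm (t *: m) = `|t|.
  by rewrite /enorm dotZl dotZr sphere2_dot// mulr1 -expr2 sqrtr_sqr.
by lra.
Unshelve. all: by end_near. Qed.

(** Product rule in [E0_perturbed], with [N 0 = 1] and derivative [dot n m] of [N]; that formula is
    used only near 0. *)
Let is_derive_E0 m g : sphere2 m -> is_derive (0 : R) 1 (G m) g ->
  is_derive (0 : R) 1 (fun t => E0 M nu (perturbed m t)) (c * (dot n m * G m 0 - g)).
Proof.
move=> m1 dG; pose N := qsqrt 1 (dot n m) 1.
have N0 : N 0 = 1 by rewrite /N qsqrt0 sqrtr1.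
have dN : is_derive (0 : R) 1 N (dot n m).
  by have := is_derive_qsqrt 1 (dot n m) 1 ltr01; rewrite sqrtr1 divr1.
have dV : is_derive (0 : R) 1 (fun t => (N t)^-1) (- dot n m).
  have := is_deriveV (f := N) (x := 0) (t := dot n m) (v := 1).
  rewrite N0 oner_neq0 => /(_ isT dN).
  by rewrite expr1n invr1 scaleN1r.
have dE : is_derive (0 : R) 1 (fun t => c * (fine (mu D) - (N t)^-1 * G m t))
    (c * (dot n m * G m 0 - g)).
  have d1 := is_deriveM dV dG.
  have d2 := is_deriveB (is_derive_cst (fine (mu D)) (0 : R) (1 : R)) d1.
  have d3 := is_deriveZ c d2.
  apply: is_derive_eq d3 _.
  by rewrite N0 invr1 scale1r sub0r [_ *: _]mulrN; rewrite /GRing.scale/=; ring.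
apply: near_eq_is_derive dE; apply: filterS (perturbed_near m m1) => t N0t.
by rewrite E0_perturbed// enorm_perturbed.
Qed.

Let S w := Num.sqrt (A w).
Let F w := (S w)^-1 *: (dot (nu w) n *: nu w - dot (nu w) n ^+ 2 *: n).

Let A_neq0 w : D w -> (A w != 0) = (S w != 0).
Proof. by move=> Dw; rewrite sqrtr_eq0 eq_le (C_ge0 n n1 w Dw) andbT. Qed.

(** The numerator has squared norm [dot (nu w) n ^+ 2 * A w]; where [S w = 0], [F w] is 0 by
    convention. *)
Let enorm_F w : D w -> enorm (F w) <= 1.
Proof.
move=> Dw; have nw1 := sphere2_dot _ (nu1 w Dw).
rewrite -sqrtr1 ler_wsqrtr// /F dotZl dotZr.
rewrite !(dotDl, dotDr, dotNl, dotNr, dotZl, dotZr) nw1 (sphere2_dot _ n1) (dotC n).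
have [->|S0] := eqVneq (S w) 0; first by rewrite invr0 mul0r.
have S2 : S w ^+ 2 = A w by rewrite sqr_sqrtr// (C_ge0 n n1).
rewrite mulrA -invfM -expr2 S2 ler_pdivrMl ?mulr1; last first.
  by rewrite -S2 exprn_even_gt0.
have := sqr_ge0 (A w); rewrite /A; lra.
Qed.

Let integrable_F i : mu.-integrable D (EFin \o (fun w => F w 0 i)).
Proof.
apply: (bounded_integrable _ _ _ _ _ measurable_surface surface_finite _ 1).
  have -> : (fun w => F w 0 i) = (fun w => (S w)^-1 *
      (dot (nu w) n * nu w 0 i - dot (nu w) n ^+ 2 * n 0 i)).
    by apply/funext => w; rewrite !mxE.
  apply: measurable_funM.
    apply: measurable_inv; last by move=> w _; exact: sqrtr_ge0.
    by apply: measurable_sqrt; exact: measurable_A.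
  apply: measurable_funB; apply: measurable_funM.
  - exact: measurable_dot_normal.
  - exact: measurable_normal_coord.
  - by apply: measurable_funX; exact: measurable_dot_normal.
  - exact: measurable_cst.
by move=> w /enorm_F; apply: le_trans; exact: coord_le_enorm.
Qed.

Let dot_vintegral m : dot (vintegral M F) m = \int[mu]_(w in D) dot (F w) m.
Proof.
have iFm i : mu.-integrable D (EFin \o (fun w => F w 0 i * m 0 i)).
  by have := integrableZr measurable_surface (m 0 i) (integrable_F i).
have -> : (fun w => dot (F w) m) = (fun w => F w 0 0 * m 0 0 +
    (F w 0 (lift 0 0) * m 0 (lift 0 0) + F w 0 (lift 0 (lift 0 0)) * m 0 (lift 0 (lift 0 0)))).
  by apply/funext => w; rewrite /dot !big_ord_recl big_ord0 addr0.
have iD f g : mu.-integrable D (EFin \o f) -> mu.-integrable D (EFin \o g) ->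
  mu.-integrable D (EFin \o (fun w => f w + g w)).
  by move=> mf mg; have := integrableD measurable_surface mf mg.
have mD := measurable_surface.
rewrite (RintegralD mD (iFm 0) (iD _ _ (iFm _) (iFm _))) (RintegralD mD (iFm _) (iFm _)).
rewrite !(RintegralZr _ mD (integrable_F _)).
by rewrite /dot !big_ord_recl big_ord0 addr0 !mxE.
Qed.

Let is_derive_E0_ae m : sphere2 m ->
  {ae mu, forall w, M w -> S w != 0} ->
  is_derive (0 : R) 1 (fun t => E0 M nu (perturbed m t)) (c * dot (vintegral M F) m).
Proof.
move=> m1 S0; rewrite dot_vintegral.
have A0 : {ae mu, forall w, D w -> A w != 0}.
  apply: negligibleS S0 => w /=; apply: contra_not => S0 Dw.
  by rewrite A_neq0// S0.
have dG := is_derive_integral_qsqrt _ _ _ mu D A (B m) (C m) 1 measurable_surface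
  surface_finite measurable_A (measurable_B m) (measurable_C m) (C_ge0 n n1)
  (C_ge0 m m1) (BAC m m1) (C_le1 n) (C_le1 m) A0.
apply: is_derive_eq (is_derive_E0 _ _ m1 dG) _.
have mD := measurable_surface.
have iB := integrable_ratio _ _ _ mu D A (B m) (C m) 1 mD surface_finite measurable_A
  (measurable_B m) (C_ge0 n n1) (C_ge0 m m1) (BAC m m1) (C_le1 m).
rewrite /G -(RintegralZl _ mD (integrable_perimeter m 0 m1)) -(RintegralB mD _ iB); last first.
  by have := integrableZl mD (dot n m) (integrable_perimeter m 0 m1).
(* Pointwise, [dot n m * S w - B m w / S w] equals [dot (F w) m]; multiplying by [S w] clears the
   denominators. *)
congr (_ * _); apply: eq_Rintegral => w /set_mem Dw.
rewrite qsqrt0 -/(S w) /F dotZl dotDl dotNl !dotZl.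
have [->|Sw0] := eqVneq (S w) 0; first by rewrite invr0 !mulr0 mul0r subr0.
have S2 : S w ^+ 2 = A w by rewrite sqr_sqrtr// (C_ge0 n n1).
apply: (mulfI Sw0); rewrite mulrA divff// mul1r mulrBr [S w * (_ / _)]mulrCA divff//.
by rewrite mulrCA -expr2 S2 /A /B; ring.
Qed.

Lemma critical_pointP : critical_point (E0 M nu) n <->
  {ae mu, forall w, M w -> S w != 0} /\ vintegral M F = 0.
Proof.
split=> [crit|[S0 F0] m m1]; last first.
  have := is_derive_E0_ae m m1 S0; rewrite F0.
  have -> : dot 0 m = 0 :> R by rewrite -(scale0r m) dotZl mul0r.
  by rewrite mulr0.
have S0 : {ae mu, forall w, M w -> S w != 0}.
  have [m m1 nm] := exists_unit_orthogonal R n.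
  exists (D `&` [set w | A w = 0]); split.
  - exact: measurable_A measurable_surface _ (measurable_set1 0).
  - apply: (derivable_perimeter_null m m1 nm).
    (* Near 0, [G m] is the norm of [n + t *: m] times [fine (mu D) - c^-1 * E0], so it inherits
       differentiability from the energy. *)
    have dN : is_derive (0 : R) 1 (qsqrt 1 (dot n m) 1) (dot n m / Num.sqrt 1).
      exact: is_derive_qsqrt.
    have d1 := is_deriveZ c^-1 (crit m m1).
    have d2 := is_deriveB (is_derive_cst (fine (mu D)) (0 : R) (1 : R)) d1.
    have [dG _] := is_deriveM dN d2.
    apply: near_eq_derivable dG; apply: filterS (perturbed_near m m1) => t N0t.
    change (qsqrt 1 (dot n m) 1 t * (fine (mu D) -
      c^-1 * E0 M nu (perturbed m t)) = G m t).
    rewrite E0_perturbed// -enorm_perturbed// mulKf//.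
    by rewrite subKr mulrA divff ?gt_eqF// mul1r.
  - move=> w /= /not_implyP[Mw /negP]; rewrite -A_neq0// negbK => /eqP Aw.
    by split.
split=> //; apply/rowP => i; rewrite [RHS]mxE.
(* Testing criticality with the basis vectors gives the coordinates of the integral, since [c] is
   nonzero and derivatives are unique. *)
have e1 : sphere2 (delta_mx 0 i : 'rV[R]_3).
  rewrite /sphere2/= /enorm /dot (bigD1 i)//= big1 => [|j /negPf ji].
    by rewrite !mxE !eqxx mulr1 addr0 sqrtr1.
  by rewrite !mxE eqxx ji mulr0.
have [_ d0] := crit _ e1; have [_] := is_derive_E0_ae _ e1 S0.
rewrite d0 => /esym/eqP; rewrite mulf_eq0 (negPf c_neq0)/= => /eqP V0.
transitivity (dot (vintegral M F) (delta_mx 0 i)); last exact: V0.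
rewrite [RHS](bigD1 i)//= big1 => [|j /negPf ji].
  by rewrite [delta_mx _ _ _ _]mxE !eqxx mulr1 addr0.
by rewrite [delta_mx _ _ _ _]mxE eqxx ji mulr0.
Qed.
End energy.

(* The equation [vintegral ... = 0] presupposes that its integrand is defined
   almost everywhere; since [x / 0] is 0 here, this is spelled out. *)
Theorem proposition6p1 (R : realType) (M Omega : set 'rV[R]_3)
    (nu : 'rV[R]_3 -> 'rV[R]_3)
    (M_surface : C21_surface M) (M_connected : connected M)
    (M_compact : compact M)
    (M_bounds : bounds_compact_domain M Omega)
    (nu_normal : outward_unit_normal M Omega nu)
    (n_oo : 'rV[R]_3) (n_oo_S2 : sphere2 n_oo) :
  critical_point (E0 M nu) n_oo <->
  {ae H2 R 2, forall w, M w -> Num.sqrt (1 - dot (nu w) n_oo ^+ 2) != 0} /\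
  vintegral M (fun w =>
    (Num.sqrt (1 - dot (nu w) n_oo ^+ 2))^-1 *:
      (dot (nu w) n_oo *: nu w - dot (nu w) n_oo ^+ 2 *: n_oo)) = 0.
Proof.
have [nu_cont nuP] := nu_normal.
by apply: critical_pointP => // w /nuP[].
Qed.
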